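(* Let $X$ be a nonempty set with basepoint $b\in X$, and let $(A^t)_{t\ge 0}$ be a max-plus linear semigroup with kernel on $X$ such that (i) $A^*(x,y)$ is finite for all $x,y\in X$, and (ii) for all $t\ge 0$ and $x,y\in X$, $A^t(x,y)=\sup_\gamma I(\gamma)$, where the supremum is over all paths $\gamma:[0,t]\to X$ from $x$ to $y$. If $\gamma:\mathbb{R}_+\to X$ is an almost-geodesic, then $K(\cdot,\gamma(t))$ converges (pointwise on $X$) as $t$ tends to infinity to some $w\in\mathscr{M}^m$.
   Context: Semigroup. Write $\mathbb{R}_{\max}=\mathbb{R}\cup\{-\infty\}$ and $\overline{\mathbb{R}}_{\max}=\mathbb{R}\cup\{\pm\infty\}$, with $-\infty$ absorbing for addition; suprema of empty sets are $-\infty$. A max-plus linear semigroup with kernel on a set $X$ is a family $(A^t)_{t\ge0}$ of operators from $\overline{\mathbb{R}}_{\max}^X$ to itself such that each $A^t$ has the form $A^tg(x)=\sup_{y\in X}(A^t(x,y)+g(y))$ for some kernel $(x,y)\mapsto A^t(x,y)\in\overline{\mathbb{R}}_{\max}$, with $A^0=I$ (the identity operator, with kernel $0$ if $x=y$ and $-\infty$ otherwise) and $A^{s+t}=A^sA^t$ (composition) for all $s,t\ge0$. Equivalently to the last property, $A^{s+t}(x,y)=\sup_{z\in X}(A^s(x,z)+A^t(z,y))$. A function $\phi:X\to\mathbb{R}_{\max}$ is harmonic if $A^t\phi=\phi$ for all $t\ge0$. Martin space. Put $A^*=\sup_{t\ge0}A^t$, i.e. $A^*(x,y)=\sup_{t\ge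 0}A^t(x,y)$. The Martin kernel is $K(x,y)=A^*(x,y)-A^*(b,y)$. The Martin space $\mathscr{M}$ is the closure of $\mathscr{K}=\{K(\cdot,y)\mid y\in X\}\subset\mathbb{R}^X$ in the topology of pointwise convergence (with the induced topology). For $\xi:X\to\mathbb{R}_{\max}$ and $\eta\in\mathscr{M}$, $$\mu_\xi(\eta):=\inf_{W\ni\eta}\ \sup_{x\in X,\ K(\cdot,x)\in W}\left(A^*(b,x)+\xi(x)\right),$$ the infimum being over all neighbourhoods $W$ of $\eta$ in $\mathscr{M}$. For $\eta,\xi\in\mathscr{M}$ set $H(\eta,\xi):=\mu_\xi(\eta)$. The minimal boundary $\mathscr{M}^m$ is the set of $\xi\in\mathscr{M}$ that are harmonic and satisfy $H(\xi,\xi)=0$. Paths. A path is an arbitrary map $\gamma$ from a closed interval of $\mathbb{R}_+=[0,\infty)$ to $X$. For $t_0<t_1<\dots<t_n$ in the domain of $\gamma$, $I(t_0,\dots,t_n;\gamma):=\sum_{i=0}^{n-1}A^{t_{i+1}-t_i}(\gamma(t_i),\gamma(t_{i+1}))$. The reward of $\gamma:[s_0,s_1]\to X$ is $I(\gamma):=\inf I(t_0,\dots,t_n;\gamma)$, the infimum being over all finite increasing sequences in $[s_0,s_1]$ with $t_0=s_0$ and $t_n=s_1$. An almost-geodesic with parameter $\epsilon$ is a path $\gamma:\mathbb{R}_+\to X$ such that for all $n\in\mathbb{N}$ with $n\ge1$ and all $0\le t_1<t_2<\dots<t_n$, $I(t_1,\dots,t_n;\gamma)\ge A^*(\gamma(t_1),\gamma(t_n))-\epsilon$.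 An almost-geodesic is a path that is an almost-geodesic with parameter $\epsilon$ for some real $\epsilon>0$. *)

(* Defs.v *)
From HB Require Import structures.
From mathcomp Require Export all_boot all_order all_algebra.
From mathcomp Require Export all_classical all_reals all_analysis.

Set Implicit Arguments.
Unset Strict Implicit.
Unset Printing Implicit Defensive.

Import Order.TTheory GRing.Theory Num.Theory.
Import numFieldNormedType.Exports.

Local Open Scope classical_set_scope.
Local Open Scope ring_scope.
Local Open Scope ereal_scope.

(* Throughout, the addition of \bar R is the one of ereal_scope, for which
   -oo is absorbing (+oo + -oo = -oo), and ereal_sup set0 = -oo. *)

Section MaxPlus.
Variables (R : realType) (X : Type).

Definition mp_op (k : X -> X -> \bar R) (g : X -> \bar R) : X -> \bar R :=
  fun x => ereal_sup [set k x y + g y | y in [set: X]].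

(* A t is the kernel of the operator A^t; only the values of A at t >= 0
   are ever used. *)
Variable A : R -> X -> X -> \bar R.

Definition mp_semigroup : Prop :=
  mp_op (A 0%R) = id /\
  forall s t : R, (0 <= s)%R -> (0 <= t)%R ->
    mp_op (A (s + t)%R) = mp_op (A s) \o mp_op (A t).

Definition harmonic (phi : X -> \bar R) : Prop :=
  (forall x, phi x != +oo) /\
  forall t : R, (0 <= t)%R -> mp_op (A t) phi = phi.

Definition Astar (x y : X) : \bar R :=
  ereal_sup [set A t x y | t in [set t : R | (0 <= t)%R]].

(* The Martin kernel is real-valued as soon as Astar is, and [fine] is then
   just the identification of finite elements of \bar R with reals. *)
Definition martin_kernel (b x y : X) : R := fine (Astar x y - Astar b y).

Definition martin_point (b y : X) : {ptws X -> R} :=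
  fun x => martin_kernel b x y.

Definition martin_space (b : X) : set {ptws X -> R} :=
  closure (range (martin_point b)).

(* The sets W in [within (martin_space b) (nbhs eta)] are those whose trace on
   the Martin space is a neighbourhood of eta in the induced topology. As every
   [martin_point b x] lies in the Martin space, only this trace matters. *)
Definition mu (b : X) (xi : X -> \bar R) (eta : {ptws X -> R}) : \bar R :=
  ereal_inf
    [set ereal_sup [set Astar b x + xi x | x in [set x | W (martin_point b x)]]
    | W in within (martin_space b) (nbhs eta)].

Definition martin_H (b : X) (eta xi : {ptws X -> R}) : \bar R :=
  mu b (fun x => (xi x)%:E) eta.

Definition minimal_boundary (b : X) : set {ptws X -> R} :=
  [set xi | [/\ martin_space b xi, harmonic (fun x => (xi x)%:E)
              & martin_H b xi xi = 0]].

(* A path on an interval is represented by a map on the whole of R, whose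
   values outside of the interval are irrelevant. *)

(* I(t_0, ..., t_n; gam) for s = [:: t_0; ...; t_n] *)
Definition seq_reward (gam : R -> X) (s : seq R) : \bar R :=
  \sum_(i < (size s).-1)
    A (s`_i.+1 - s`_i)%R (gam s`_i%R) (gam s`_i.+1%R).

Definition path_reward (s0 s1 : R) (gam : R -> X) : \bar R :=
  ereal_inf [set seq_reward gam (s0 :: s)
            | s in [set s | path <%R s0 s /\ last s0 s = s1]].

Definition almost_geodesic_with (eps : R) (gam : R -> X) : Prop :=
  forall (t1 : R) (s : seq R), (0 <= t1)%R -> path <%R t1 s ->
    Astar (gam t1) (gam (last t1 s)) - eps%:E <= seq_reward gam (t1 :: s).

Definition almost_geodesic (gam : R -> X) : Prop :=
  exists2 eps : R, (0 < eps)%R & almost_geodesic_with eps gam.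

End MaxPlus.

(* Main.v *)
Require Import Defs.
From mathcomp Require Import all_boot all_order all_algebra.
From mathcomp Require Import all_classical all_reals all_analysis.
From mathcomp Require Import lra.
Import Order.TTheory GRing.Theory Num.Theory.
Import numFieldNormedType.Exports.
Local Open Scope classical_set_scope.
Local Open Scope ring_scope.
Local Open Scope ereal_scope.

(** Write [a x y] for the finite number [Astar A x y].  Along an
    almost-geodesic [gam] the reward [j t] of [gam] between times [0] and [t]
    is a finite number.  It satisfies [j t - j s <= A (t - s) (gam s) (gam t)]
    and [j t >= a (gam 0) (gam t) - C] for some constant [C].  The triangle
    inequality [a x y + a y z <= a x z] therefore makes
    [a x (gam t) - j t] nondecreasing in [t] and bounded above
    ([excess_nondecreasing], [excess_bounded]).  Let [L x] be its limit; then
    the Martin kernel [a x (gam t) - a b (gam t)], a difference of two such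
    excesses, converges to [L x - L b].

    The limit inherits [a x y + L y <= L x] from the triangle inequality, which
    gives one half of harmonicity.  For the other half, a nearly optimal way of
    going from [x] to infinity is to make a nearly optimal transition to a far
    point of [gam] and to follow [gam] from there on; where this motion is at
    time [t] is a nearly optimal intermediate point ([excess_limit_approx]).

    Finally [a b y + L y - L b <= 0] for every [y] by the same inequality, so
    [martin_H] is nonpositive at the limit, while [L (gam t) >= - j t] gives
    [a b (gam t) + L (gam t) - L b >= (a b (gam t) - j t) - L b], which tends
    to [0] as [t] grows.  Since [martin_point A b (gam t)] eventually enters
    each neighbourhood of the limit, [martin_H] vanishes there. *)

(** * Pointwise convergence *)

(** The topology of [{ptws X -> V}] is a supremum of the initial topologies of
    the evaluations, each of which is surjective. *)
Lemma cvg_ptws_pointwise (X : Type) (V : uniformType)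
    (F : set_system (X -> V)) (f : X -> V) : Filter F ->
  (forall x : X, g x @[g --> F] --> f x) -> {ptws, F --> f}.
Proof.
move=> FF Ff; rewrite cvg_sup => x.
rewrite cvg_image; last by rewrite eqEsubset; split=> v // _; exists (cst v).
move=> W /= /Ff Wx; exists (@^~ x @^-1` W) => //.
by rewrite image_preimage // eqEsubset; split=> // v _; exists (cst v).
Qed.

(** * Kernels of a max-plus semigroup *)

(** A kernel is recovered from its operator by applying it to the max-plus
    Dirac mass at [y]; this turns identities of operators into identities of
    kernels. *)
Lemma mp_op_dirac (R : realType) (X : Type) (k : X -> X -> \bar R) (x y : X) :
  mp_op k (fun z => if `[< z = y >] then 0 else -oo) x = k x y.
Proof.
rewrite /mp_op; apply/eqP; rewrite eq_le; apply/andP; split.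
  apply: ge_ereal_sup => _ [z _ <-].
  by case: asboolP => [->|_]; rewrite ?adde0 // addeNy leNye.
by apply: ereal_sup_ubound; exists y => //; case: asboolP => // _; rewrite adde0.
Qed.

Section Semigroup.
Variables (R : realType) (X : Type) (A : R -> X -> X -> \bar R).
Hypothesis hA : mp_semigroup A.

Lemma kernel0_diag (x : X) : A 0%R x x = 0.
Proof.
have [A0 _] := hA; have := mp_op_dirac _ _ (A 0%R) x x.
by rewrite A0; case: asboolP.
Qed.

Lemma kernelD (s t : R) (x y : X) : (0 <= s)%R -> (0 <= t)%R ->
  A (s + t)%R x y = ereal_sup [set A s x z + A t z y | z in [set: X]].
Proof.
move=> s0 t0; have [_ AD] := hA.
rewrite -(mp_op_dirac _ _ (A (s + t)%R)) AD //= {1}/mp_op; congr ereal_sup.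
by apply/seteqP; split=> _ [z _ <-]; exists z => //; rewrite mp_op_dirac.
Qed.

Lemma kernel_le_Astar (t : R) (x y : X) : (0 <= t)%R -> A t x y <= Astar A x y.
Proof. by move=> t0; apply: ereal_sup_ubound; exists t. Qed.

Hypothesis hfin : forall x y : X, Astar A x y \is a fin_num.

Definition rAstar (x y : X) : R := fine (Astar A x y).
Local Notation a := rAstar.

Lemma rAstarE (x y : X) : Astar A x y = (a x y)%:E.
Proof. by rewrite /rAstar fineK. Qed.

Lemma martin_kernelE (b x y : X) : martin_kernel A b x y = (a x y - a b y)%R.
Proof. by rewrite /martin_kernel !rAstarE. Qed.

(** Kernels are below the finite kernel [Astar A], so that the only infinite
    value they can take is [-oo], and any lower bound makes them finite. *)
Lemma kernel_finite (t : R) (x y : X) (p : R) : (0 <= t)%R -> p%:E < A t x y ->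
  exists2 r : R, A t x y = r%:E & (p < r)%R.
Proof.
move=> t0; have := kernel_le_Astar _ x y t0; rewrite rAstarE.
by case: (A t x y) => // r _; rewrite lte_fin => pr; exists r.
Qed.

Lemma kernel_compose (s t r q : R) (x z y : X) : (0 <= s)%R -> (0 <= t)%R ->
  r%:E <= A s x z -> q%:E <= A t z y -> (r + q)%:E <= A (s + t)%R x y.
Proof.
move=> s0 t0 rA qA; rewrite kernelD // EFinD.
by apply: le_trans (leeD rA qA) _; apply: ereal_sup_ubound; exists z.
Qed.

(** Kernels never take the value [+oo], and [-oo] is absorbing, so that a finite
    lower bound of a sum of two kernels makes both terms finite. *)
Lemma kernel_split (s t p : R) (x y : X) : (0 <= s)%R -> (0 <= t)%R ->
  p%:E < A (s + t)%R x y ->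
  exists z r q, [/\ A s x z = r%:E, A t z y = q%:E & (p < r + q)%R].
Proof.
move=> s0 t0; rewrite kernelD // => /ereal_sup_gt[_ [z _ <-]] pA.
exists z; move: pA.
have := kernel_le_Astar _ x z s0; have := kernel_le_Astar _ z y t0.
rewrite !rAstarE.
case: (A s x z) => [r||] //; case: (A t z y) => [q||] // _ _.
by rewrite -EFinD lte_fin => prq; exists r, q.
Qed.

Lemma rAstar_approx (x y : X) (d : R) : (0 < d)%R ->
  exists t r : R, [/\ (0 <= t)%R, A t x y = r%:E & (a x y - d < r)%R].
Proof.
move=> d0.
have : (a x y - d)%:E < Astar A x y by rewrite rAstarE lte_fin; lra.
move=> /ereal_sup_gt[_ [t t0 <-]] /(kernel_finite _ _ _ _ t0)[r rE dr].
by exists t, r.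
Qed.

Lemma kernel_le_rAstar (t r : R) (x y : X) : (0 <= t)%R ->
  r%:E <= A t x y -> (r <= a x y)%R.
Proof.
move=> t0 rA; rewrite -lee_fin -rAstarE.
exact: le_trans rA (kernel_le_Astar _ _ _ t0).
Qed.

Lemma rAstar_diag_ge0 (x : X) : (0 <= a x x)%R.
Proof.
by apply: (@kernel_le_rAstar 0%R) => //; rewrite kernel0_diag.
Qed.

Lemma rAstar_triangle (x y z : X) : (a x y + a y z <= a x z)%R.
Proof.
apply/ler_addgt0Pr => e e0.
have e20 : (0 < e / 2)%R by lra.
have [s [r [s0 sE rd]]] := rAstar_approx x y _ e20.
have [t [q [t0 tE qd]]] := rAstar_approx y z _ e20.
have : (r + q <= a x z)%R.
  apply: (@kernel_le_rAstar (s + t)%R); first exact: addr_ge0.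
  by apply: (@kernel_compose _ _ _ _ _ y) => //; rewrite ?sE ?tE.
lra.
Qed.

(** * The reward along an almost-geodesic *)

Lemma seq_reward_rcons (gam : R -> X) (t0 t : R) (s : seq R) :
  seq_reward A gam (t0 :: rcons s t) =
  seq_reward A gam (t0 :: s) +
  A (t - last t0 s)%R (gam (last t0 s)) (gam t).
Proof.
have nthE k : (k <= size s)%N -> (t0 :: rcons s t)`_k = (t0 :: s)`_k.
  by move=> ks; rewrite -rcons_cons nth_rcons /= ltnS ks.
have lastE : (t0 :: rcons s t)`_(size s).+1 = t.
  by rewrite -rcons_cons nth_rcons /= ltnn eqxx.
rewrite /seq_reward /= size_rcons big_ord_recr /=; congr (_ + _).
  apply: eq_bigr => i _; have /= -> := nthE i.+1 (ltn_ord i).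
  by rewrite (nthE i) // ltnW.
by move: lastE => /= ->; rewrite (nthE (size s)) // (nth_last 0%R (t0 :: s)).
Qed.

(** The number [j t] is the reward of [gam] between times [0] and [t].  Appending [t] to a subdivision of the interval from [0]
    to [s] adds exactly one term to its reward; taking the infimum over the
    subdivisions gives [j t <= j s + A (t - s) (gam s) (gam t)].  The constant
    [C] is the parameter of the almost-geodesic. *)
Lemma almost_geodesic_reward (gam : R -> X) : almost_geodesic A gam ->
  exists (j : R -> R) (C : R),
    (forall t, (0 <= t)%R -> (a (gam 0%R) (gam t) <= j t + C)%R) /\
    (forall s t, (0 <= s)%R -> (s <= t)%R ->
       (j t - j s)%:E <= A (t - s)%R (gam s) (gam t)).
Proof.
move=> [eps eps0 hgam].
pose J t := path_reward A 0%R t gam.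
have Jge t : (a (gam 0%R) (gam t) - eps)%:E <= J t.
  apply: le_ereal_inf_tmp => _ [s [s_path <-] <-].
  by rewrite EFinB -rAstarE; apply: hgam.
have Jrcons s t : path <%R 0%R s -> (last 0%R s < t)%R ->
    J t <= seq_reward A gam (0%R :: s) +
           A (t - last 0%R s)%R (gam (last 0%R s)) (gam t).
  move=> s_path st; rewrite -seq_reward_rcons; apply: ereal_inf_lbound.
  by exists (rcons s t) => //; rewrite /= rcons_path last_rcons s_path.
have r0 : seq_reward A gam [:: 0%R] = 0 by rewrite /seq_reward big_ord0.
have Jfin t : (0 <= t)%R -> J t \is a fin_num.
  move=> t0; rewrite fin_numElt (lt_le_trans _ (Jge t)) ?ltNyr //=.
  move: t0; rewrite le_eqVlt => /predU1P[<-|t0].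
    apply: (@le_lt_trans _ _ 0) => //.
    by rewrite -r0; apply: ereal_inf_lbound; exists [::].
  apply: le_lt_trans (Jrcons [::] t isT t0) _.
  rewrite r0 add0e /=; apply: le_lt_trans (kernel_le_Astar _ _ _ _) _.
    by rewrite subr0 ltW.
  by rewrite rAstarE ltry.
have JD s t : (0 <= s)%R -> (s < t)%R ->
    J t <= J s + A (t - s)%R (gam s) (gam t).
  move=> s0 st; apply/lee_addgt0Pr => e e0.
  have [_ [u [u_path us] <-] ue] := lb_ereal_inf_adherent e0 (Jfin s s0).
  rewrite addeAC; apply: le_trans (Jrcons u t u_path _) _; first by rewrite us.
  by rewrite us; apply: leeD => //; apply: ltW.
exists (fine \o J), eps; split=> [t t0|s t s0].
  by have := Jge t; rewrite /= -lerBlDr -lee_fin fineK ?Jfin.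
rewrite le_eqVlt => /predU1P[<-|st]; first by rewrite !subrr kernel0_diag.
have t0 : (0 <= t)%R by apply: le_trans (ltW st).
by rewrite EFinB !fineK ?Jfin // leeBlDl ?Jfin // JD.
Qed.

(** * The limit of the Martin kernels *)

Section Limit.
Variables (gam : R -> X) (j : R -> R) (C : R).
Hypothesis j_bound : forall t, (0 <= t)%R -> (a (gam 0%R) (gam t) <= j t + C)%R.
Hypothesis j_incr : forall s t, (0 <= s)%R -> (s <= t)%R ->
  (j t - j s)%:E <= A (t - s)%R (gam s) (gam t).

(** Up to the additive term [j t], which is independent of [x], this is
    [Astar A x (gam t)]; differences in [x] are thus values of Martin kernels. *)
Definition excess (x : X) (t : R) : R := (a x (gam t) - j t)%R.

Lemma excess_nondecreasing (x : X) (s t : R) :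
  (0 <= s)%R -> (s <= t)%R -> (excess x s <= excess x t)%R.
Proof.
move=> s0 st; rewrite /excess.
have := rAstar_triangle x (gam s) (gam t).
have : (j t - j s <= a (gam s) (gam t))%R.
  by apply: (@kernel_le_rAstar (t - s)%R) (j_incr _ _ s0 st); lra.
lra.
Qed.

Lemma excess_bounded (x : X) (t : R) :
  (0 <= t)%R -> (excess x t <= C - a (gam 0%R) x)%R.
Proof.
move=> t0; have := rAstar_triangle (gam 0%R) x (gam t).
by have := j_bound _ t0; rewrite /excess; lra.
Qed.

(** Times are clamped to be nonnegative, because nothing is known of [gam] and
    [j] at negative times. *)
Definition excess_limit (x : X) : R :=
  sup (range (fun t => excess x (Num.max t 0%R))).
Local Notation L := excess_limit.

Lemma excess_clamp_ubound (x : X) :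
  has_ubound (range (fun t => excess x (Num.max t 0%R))).
Proof.
exists (C - a (gam 0%R) x)%R => _ [t _ <-].
by apply: excess_bounded; rewrite le_max lexx orbT.
Qed.

Lemma excess_cvg (x : X) : excess x t @[t --> +oo%R] --> L x.
Proof.
apply: cvg_trans (nondecreasing_cvgr _ (excess_clamp_ubound x)).
  apply: near_eq_cvg; near=> t; congr excess; apply/max_idPl.
  by near: t; apply: nbhs_pinfty_ge; rewrite num_real.
move=> s t st; apply: excess_nondecreasing; first by rewrite le_max lexx orbT.
by rewrite ge_max !le_max st lexx orbT.
Unshelve. all: by end_near. Qed.

Lemma excess_le_limit (x : X) (t : R) : (0 <= t)%R -> (excess x t <= L x)%R.
Proof.
move=> t0; apply: ub_le_sup; first exact: excess_clamp_ubound.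
by exists t => //; congr excess; apply/max_idPl.
Qed.

Lemma excess_approx (x : X) (d : R) : (0 < d)%R ->
  exists2 t : R, (0 <= t)%R & (L x - d < excess x t)%R.
Proof.
move=> d0.
have [|_ [t _ <-] tL] := @sup_adherent _
    (range (fun t => excess x (Num.max t 0%R))) _ d0.
  by split; [exists (excess x (Num.max 0 0)%R), 0%R|exact: excess_clamp_ubound].
by exists (Num.max t 0%R); rewrite // le_max lexx orbT.
Qed.

Lemma excess_limit_triangle (x y : X) : (a x y + L y <= L x)%R.
Proof.
rewrite -lerBrDl; apply: ge_sup; first by exists (excess y (Num.max 0 0)%R), 0%R.
move=> _ [t _ <-]; set u := Num.max t 0%R.
have u0 : (0 <= u)%R by rewrite le_max lexx orbT.
have := excess_le_limit x u u0.
by have := rAstar_triangle x y (gam u); rewrite /excess; lra.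
Qed.

(** The excess of [gam t] is already at least [- j t] at time [t], because
    [Astar A] is nonnegative on the diagonal. *)
Lemma excess_limit_ray (t : R) : (0 <= t)%R -> (- j t <= L (gam t))%R.
Proof.
move=> /(excess_le_limit (gam t)); rewrite /excess.
by have := rAstar_diag_ge0 (gam t); lra.
Qed.

(** A nearly optimal transition from [x] to a far point [gam T] of the ray takes
    some time [s], and is then continued along the ray.  If [s <= t], this motion is on the ray at time [t];
    otherwise it is at an intermediate point between [x] and [gam T]. *)
Lemma excess_limit_approx (x : X) (t d : R) : (0 <= t)%R -> (0 < d)%R ->
  exists y : X, (L x - d)%:E <= A t x y + (L y)%:E.
Proof.
move=> t0 d0; have d20 : (0 < d / 2)%R by lra.
have [T T0 TL] := excess_approx x _ d20.
have [s [r [s0 sE rd]]] := rAstar_approx x (gam T) _ d20.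
rewrite /excess in TL.
have [st|ts] := leP s t.
  have T'0 : (0 <= T + (t - s))%R by lra.
  exists (gam (T + (t - s))%R).
  have jT : (j (T + (t - s)) - j T)%:E <= A (t - s)%R (gam T) (gam (T + (t - s))%R).
    by have := j_incr T (T + (t - s))%R T0; rewrite (addrC T) addrK; apply; lra.
  have At : (r + (j (T + (t - s)) - j T))%:E <= A t x (gam (T + (t - s))%R).
    rewrite -{2}(subrKC s t); apply: kernel_compose jT; rewrite ?sE //; lra.
  apply: le_trans (leeD2r _ At); rewrite -EFinD lee_fin.
  by have := excess_limit_ray _ T'0; lra.
have st0 : (0 <= s - t)%R by lra.
have : (a x (gam T) - d / 2)%:E < A (t + (s - t))%R x (gam T).
  by rewrite subrKC sE lte_fin.
move=> /(kernel_split _ _ _ _ _ t0 st0)[z [p [q [pE qE dpq]]]].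
exists z; rewrite pE -EFinD lee_fin.
have : (q <= a z (gam T))%R by apply: (kernel_le_rAstar _ _ _ _ st0); rewrite qE.
by have := excess_le_limit z T T0; rewrite /excess; lra.
Qed.

Definition martin_limit (b : X) : {ptws X -> R} := fun x => (L x - L b)%R.

Lemma martin_kernel_cvg (b x : X) :
  martin_kernel A b x (gam t) @[t --> +oo%R] --> martin_limit b x.
Proof.
have -> : (fun t => martin_kernel A b x (gam t)) = (excess x \- excess b)%R.
  by apply/funext => t; rewrite martin_kernelE /excess /=; lra.
by apply: cvgB; apply: excess_cvg.
Qed.

Lemma martin_point_cvg (b : X) :
  martin_point A b (gam t) @[t --> +oo%R] --> martin_limit b.
Proof. by apply: cvg_ptws_pointwise => x; apply: martin_kernel_cvg. Qed.

Lemma martin_limit_space (b : X) : martin_space A b (martin_limit b).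
Proof.
move=> W /martin_point_cvg near_W.
have [t Wt] := @filter_ex _ _ (proper_pinfty_nbhs) _ near_W.
by exists (martin_point A b (gam t)); split => //; exists (gam t).
Qed.

Lemma martin_limit_harmonic (b : X) :
  Defs.harmonic A (fun x => (martin_limit b x)%:E).
Proof.
split=> // t t0; apply/funext => x; apply/eqP; rewrite eq_le; apply/andP; split.
  apply: ge_ereal_sup => _ [y _ <-].
  apply: le_trans (leeD2r _ (kernel_le_Astar _ _ _ t0)) _.
  rewrite rAstarE -EFinD lee_fin /martin_limit.
  by have := excess_limit_triangle x y; lra.
apply/lee_addgt0Pr => d d0; have [y yL] := excess_limit_approx x t d t0 d0.
rewrite -leeBlDr //; apply: (@le_trans _ _ (A t x y + (martin_limit b y)%:E)).
  rewrite /martin_limit [(L y - _)%:E]EFinB addeA.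
  apply: le_trans (leeD2r (- (L b)%:E) yL).
  by rewrite -!EFinB lee_fin; lra.
by apply: ereal_sup_ubound; exists y.
Qed.

(** The bound from above already holds for the neighbourhood [setT]; the bound
    from below is read on the points [gam t] for large [t]. *)
Lemma martin_limit_H (b : X) : martin_H A b (martin_limit b) (martin_limit b) = 0.
Proof.
apply/eqP; rewrite eq_le; apply/andP; split.
  apply: ge_ereal_inf; eexists.
    by exists setT; [exact: filterT|reflexivity].
  apply: ge_ereal_sup => _ [x _ <-].
  rewrite rAstarE -EFinD lee_fin /martin_limit.
  by have := excess_limit_triangle b x; lra.
apply: le_ereal_inf_tmp => _ [W W_nbhs <-].
apply/lee_addgt0Pr => d d0.
have near_W : \forall t \near +oo%R, W (martin_point A b (gam t)).
  have : \forall t \near +oo%R, martin_space A b (martin_point A b (gam t)) ->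
      W (martin_point A b (gam t)) := martin_point_cvg b _ W_nbhs.
  by apply: filterS => t; apply; apply: subset_closure; exists (gam t).
have near_b : \forall t \near +oo%R, (L b - d < excess b t)%R.
  have [T T0 TL] := excess_approx b _ d0.
  apply: filterS (nbhs_pinfty_ge (num_real T)) => t Tt.
  exact: lt_le_trans TL (excess_nondecreasing b _ _ T0 Tt).
(* [gam t] enters the supremum of the Martin points lying in [W]. *)
have [t [[Wt bt] t0]] := @filter_ex _ _ proper_pinfty_nbhs _
  (filterI (filterI near_W near_b) (nbhs_pinfty_ge (num_real (0 : R)%R))).
rewrite -leeBlDr //; apply: (@le_trans _ _
    (Astar A b (gam t) + (martin_limit b (gam t))%:E)).
  rewrite rAstarE sub0e -EFinD lee_fin /martin_limit.
  by have := excess_limit_ray _ t0; move: bt; rewrite /excess; lra.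
by apply: ereal_sup_ubound; exists (gam t).
Qed.

End Limit.
End Semigroup.

Theorem proposition3p9 (R : realType) (X : Type) (b : X)
  (A : R -> X -> X -> \bar R)
  (hA : mp_semigroup A)
  (hfin : forall x y : X, Astar A x y \is a fin_num)
  (hpath : forall (t : R) (x y : X), (0 <= t)%R ->
     A t x y = ereal_sup [set path_reward A 0%R t gam
                         | gam in [set gam : R -> X | gam 0%R = x /\ gam t = y]])
  (gam : R -> X) (hgam : almost_geodesic A gam) :
  exists2 w : {ptws X -> R}, minimal_boundary A b w &
    forall x : X, martin_kernel A b x (gam t) @[t --> +oo%R] --> w x.
Proof.
have [j [C [j_bound j_incr]]] := almost_geodesic_reward _ _ _ hA hfin _ hgam.
exists (martin_limit _ _ A gam j b).
  split.
  - exact: martin_limit_space j_bound j_incr b.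
  - exact: martin_limit_harmonic j_bound j_incr b.
  - exact: martin_limit_H j_bound j_incr b.
by move=> x; apply: martin_kernel_cvg j_bound j_incr b x.
Qed.
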